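(* For every $\epsilon>0$ there exist $A\in\mathbb{Q}^{m\times n}$, $b\in\mathbb{Q}^m$, $c\in\mathbb{Q}_+^n$ defining a feasible instance of $(\mathrm{P})$ with $z^I>0$, and a partition $\mathcal{J}$ of the index set $[n]$ of columns of $A$, such that $G^{\mathrm{pack}}_{A,\mathcal{J}}=(V,E)$ is a star and $$z^{S.S.}\ge|V|\cdot z^I-\epsilon .$$
   Context: $[n]=\{1,\dots,n\}$. Problem $(\mathrm{P})$ is: maximize $c^Tx$ subject to $Ax\le b$, $x_j\in\mathbb{Z}_+$ for $j\in\mathcal{L}$, $x_j\in\mathbb{R}_+$ for $j\in[n]\setminus\mathcal{L}$, where $\mathcal{L}\subseteq[n]$; here the entries of $A$ and $b$ may have any sign. Let $P$ be its feasible region, $P^I$ the convex hull of $P$, and $P^{LP}$ the feasible region of its linear programming relaxation; $z^I=\max\{c^Tx:x\in P^I\}$. Sparse closures: for $N\subseteq[n]$, a sparse cut on $N$ is an inequality $\alpha^Tx\le\beta$ valid for $P^I$ with $\alpha_i=0$ for all $i\notin N$; $P^{(N)}$ is the set of points of $P^{LP}$ satisfying all sparse cuts on $N$. For a partition $\mathcal{J}=\{J_1,\dots,J_q\}$ of $[n]$, the packing interaction graph $G^{\mathrm{pack}}_{A,\mathcal{J}}$ has one node $v_j$ for each block $J_j$, and distinct nodes $v_i,v_j$ are adjacent iff some row of $A$ has a nonzero entry in a column of $J_i$ and a nonzero entry in a column of $J_j$. A star is a graph consisting of a center adjacent to one or more leaves, with no other nodes or edges. Super sparse closure: $P^{S.S.}:=\bigcap_{j=1}^qP^{(J_j)}$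 and $z^{S.S.}:=\max\{c^Tx:x\in P^{S.S.}\}$. *)

(* Defs.v *)
From HB Require Import structures.
From mathcomp Require Import all_boot all_order all_algebra.
From mathcomp Require Import boolp classical_sets reals convex.

Set Implicit Arguments.
Unset Strict Implicit.
Unset Printing Implicit Defensive.

Import Order.TTheory GRing.Theory Num.Theory.

Local Open Scope classical_set_scope.
Local Open Scope ring_scope.

(* The index set [n] is 'I_n.  The data are rational, while points, cuts and
   optimal values are real: A, b, c are mapped into R by ratr. *)

Definition lp_feasible (R : realType) m n (A : 'M[rat]_(m, n))
    (b : 'cV[rat]_m) : set 'cV[R]_n :=
  [set x | (forall i, (map_mx ratr A *m x) i ord0 <= ratr (b i ord0)) /\
           (forall j, 0 <= x j ord0)].

Definition mip_feasible (R : realType) m n (A : 'M[rat]_(m, n))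
    (b : 'cV[rat]_m) (L : {set 'I_n}) : set 'cV[R]_n :=
  [set x | [/\ forall i, (map_mx ratr A *m x) i ord0 <= ratr (b i ord0),
               forall j, j \in L -> x j ord0 \is a Num.nat &
               forall j, j \notin L -> 0 <= x j ord0]].

Definition convex_hull (R : realType) n (S : set 'cV[R]_n) : set 'cV[R]_n :=
  smallest (@convex_set R 'cV[R]_n) S.

Definition integer_hull (R : realType) m n (A : 'M[rat]_(m, n))
    (b : 'cV[rat]_m) (L : {set 'I_n}) : set 'cV[R]_n :=
  convex_hull (mip_feasible A b L).

Definition sparse_cut (R : realType) m n (A : 'M[rat]_(m, n))
    (b : 'cV[rat]_m) (L N : {set 'I_n}) (alpha : 'cV[R]_n) (beta : R) : Prop :=
  (forall x, integer_hull A b L x -> (alpha^T *m x) ord0 ord0 <= beta) /\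
  (forall i, i \notin N -> alpha i ord0 = 0).

Definition sparse_closure (R : realType) m n (A : 'M[rat]_(m, n))
    (b : 'cV[rat]_m) (L N : {set 'I_n}) : set 'cV[R]_n :=
  [set x | lp_feasible A b x /\
           forall alpha beta, sparse_cut A b L N alpha beta ->
             (alpha^T *m x) ord0 ord0 <= beta].

Definition super_sparse_closure (R : realType) m n (A : 'M[rat]_(m, n))
    (b : 'cV[rat]_m) (L : {set 'I_n}) (J : {set {set 'I_n}}) :
    set 'cV[R]_n :=
  \bigcap_(N in [set N | N \in J]) sparse_closure A b L N.

(* z = max {c^T x : x in S}; in particular the maximum is attained. *)
Definition is_max (R : realType) n (c : 'cV[rat]_n) (S : set 'cV[R]_n)
    (z : R) : Prop :=
  let values := [set ((map_mx ratr c)^T *m x) ord0 ord0 | x in S] in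
  values z /\ ubound values z.

Definition pack_node n (J : {set {set 'I_n}}) : finType :=
  {B : {set 'I_n} | B \in J}.

Definition pack_adj m n (A : 'M[rat]_(m, n)) (J : {set {set 'I_n}}) :
    rel (pack_node J) :=
  fun u v => (u != v) &&
    [exists i, [exists j in val u, A i j != 0] &&
               [exists k in val v, A i k != 0]].

Definition is_star (V : finType) (e : rel V) : Prop :=
  (1 < #|V|)%N /\
  exists r : V, forall u v, e u v = (u != v) && ((u == r) || (v == r)).

(* Main.v *)
(* With |V| = 2 the instance "maximize x + y subject to x + y <= 2 - d, x and y
   nonnegative integers", with singleton blocks, is tight: integrality rounds
   the right-hand side down to 1, whereas each coordinate of the LP optimum
   (1, 1 - d) is the coordinate of some point of the integer hull, so that no
   cut supported on a single variable removes it. *)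
Require Import Defs.
From mathcomp Require Import all_boot all_order all_algebra.
From mathcomp Require Import boolp classical_sets reals convex.
From mathcomp Require Import interval_inference lra.

Set Implicit Arguments.
Unset Strict Implicit.
Unset Printing Implicit Defensive.

Import Order.TTheory GRing.Theory Num.Theory.

Local Open Scope classical_set_scope.
Local Open Scope ring_scope.

Lemma sub_convex_hull (R : realType) n (S : set 'cV[R]_n) :
  S `<=` convex_hull S.
Proof. exact: sub_gen_smallest. Qed.

Lemma convex_hull_segment (R : realType) n (S : set 'cV[R]_n) x y (t : R) :
  0 <= t <= 1 -> convex_hull S x -> convex_hull S y ->
  convex_hull S (t *: x + (1 - t) *: y).
Proof.
move=> t01 Sx Sy M [Mconv SM].
have := Mconv x y (Itv01 (proj1 (andP t01)) (proj2 (andP t01))).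
by rewrite !inE; apply; [exact: Sx | exact: Sy].
Qed.

(** A half-space is convex, so once it contains [S] it contains the smallest convex set around
    [S]. *)
Lemma convex_hull_le (R : realType) n (S : set 'cV[R]_n) (a : 'rV[R]_n) be :
  (forall x, S x -> (a *m x) ord0 ord0 <= be) ->
  forall x, convex_hull S x -> (a *m x) ord0 ord0 <= be.
Proof.
move=> Sle; apply: (@smallest_sub _ _ _ [set x | (a *m x) ord0 ord0 <= be]).
  move=> x y l; rewrite !inE /= => xle yle.
  have -> : conv l x y = l%:num *: (x : 'cV_n) + (1 - l%:num) *: (y : 'cV_n).
    by [].
  rewrite mulmxDr -!scalemxAr !mxE.
  have l0 : 0 <= l%:num by [].
  have l1 : l%:num <= 1 by [].
  move: xle yle; rewrite !mxE; nra.
by [].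
Qed.

(** A cut on [N] has zero coefficients outside [N], so it takes the same value at [x] and at [p],
    where it is valid. Membership in the closure thus reduces to exhibiting one hull point per
    block. *)
Lemma sparse_closure_agree (R : realType) m n (A : 'M[rat]_(m, n))
    (b : 'cV[rat]_m) (L N : {set 'I_n}) (x p : 'cV[R]_n) :
  lp_feasible A b x -> integer_hull A b L p ->
  (forall j, j \in N -> p j ord0 = x j ord0) ->
  sparse_closure A b L N x.
Proof.
move=> xlp pI px; split=> // al be [cut al0].
suff -> : al^T *m x = al^T *m p by exact: cut.
apply/matrixP => i k; rewrite !mxE ord1; apply: eq_bigr => j _; rewrite !mxE ord1.
by have [/px -> //|/al0 ->] := boolP (j \in N); rewrite !mul0r.
Qed.

Lemma ratr_ones_mul (R : realType) (x : 'cV[R]_2) i j :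
  (map_mx ratr (const_mx 1 : 'M[rat]_(1, 2)) *m x) i j = x 0 j + x 1 j.
Proof.
rewrite map_const_mx rmorph1 mxE big_ord_recl big_ord1 !mxE !mul1r.
by congr (x _ _ + x _ _); apply/val_inj.
Qed.

Lemma partition_singletons (T : finType) :
  finset.partition [set [set i] | i : T]%SET [set: T]%SET.
Proof.
apply/and3P; split.
- apply/eqP/setP => i; rewrite inE; apply/bigcupP; exists [set i]%SET.
    exact: imset_f.
  by rewrite inE.
- apply/finset.trivIsetP => _ _ /imsetP[i _ ->] /imsetP[j _ ->] ij.
  by rewrite disjoints1 inE; apply: contraNneq ij => ->.
- apply/imsetP => -[i _ /setP/(_ i)]; by rewrite !inE eqxx.
Qed.

Lemma card_pack_node_singletons n :
  #|pack_node [set [set i] | i : 'I_n]%SET| = n.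
Proof.
rewrite /pack_node card_sig -[RHS]card_ord -(card_imset _ (@set1_inj 'I_n)).
exact: eq_card.
Qed.

(** Any row joins the two blocks, and a single edge is a star with one leaf; either end may serve as
    center. *)
Lemma is_star_two_singletons m (A : 'M[rat]_(m.+1, 2)) :
  (forall i j, A i j != 0) ->
  is_star (@pack_adj _ _ A [set [set i] | i : 'I_2]%SET).
Proof.
move=> A0; split; first by rewrite card_pack_node_singletons.
have memJ (i : 'I_2) : [set i]%SET \in [set [set i] | i : 'I_2]%SET.
  exact: imset_f.
exists (Sub [set ord0]%SET (memJ ord0)) => u v; rewrite /pack_adj.
have [//|uv /=] := eqVneq u v.
have /imsetP[i _ ui] := valP u; have /imsetP[j _ vj] := valP v.
transitivity true.
  apply/existsP; exists ord0; apply/andP; split; apply/existsP.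
    by exists i; rewrite ui inE eqxx A0.
  by exists j; rewrite vj inE eqxx A0.
have {uv} ij : i != j.
  by apply: contraNneq uv => ij; apply/eqP/val_inj; rewrite ui vj ij.
set r := Sub _ _.
(* Nodes are compared through their blocks; of two distinct indices in ['I_2], one is [ord0]. *)
have eq_r (w : pack_node _) : (w == r) = (val w == [set ord0]%SET) by [].
rewrite !eq_r ui vj !(inj_eq set1_inj).
by case: i j ij {ui vj} => [[|[|//]] ?] [[|[|//]] ?].
Qed.

Theorem theorem28 (R : realType) (eps : R) (eps_gt0 : 0 < eps) :
  exists (m n : nat) (A : 'M[rat]_(m, n)) (b : 'cV[rat]_m) (c : 'cV[rat]_n)
         (L : {set 'I_n}) (J : {set {set 'I_n}}) (zI zSS : R),
    (forall j, 0 <= c j ord0) /\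
    (mip_feasible A b L : set 'cV[R]_n) !=set0 /\
    is_max c (integer_hull A b L) zI /\
    0 < zI /\
    finset.partition J [set: 'I_n]%SET /\
    is_star (@pack_adj m n A J) /\
    is_max c (super_sparse_closure A b L J) zSS /\
    #|pack_node J|%:R * zI - eps <= zSS.
Proof.
(* [eps] is real but [b] must be rational, so a reciprocal [d] of a positive integer below [eps]
   takes its place. *)
have [k] := ltr_add_invr eps_gt0; rewrite add0r => keps.
pose d : R := k.+1%:R^-1.
have d_gt0 : 0 < d by rewrite invr_gt0 ltr0n.
(* This keeps both unit vectors feasible, as [1 <= 2 - d], and the point [x] below nonnegative. *)
have d_le1 : d <= 1 by rewrite invf_le1 ?ltr0n// ler1n.
pose A : 'M[rat]_(1, 2) := const_mx 1.
pose b : 'cV[rat]_1 := const_mx (2 - k.+1%:R^-1).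
pose c : 'cV[rat]_2 := const_mx 1.
pose L := [set: 'I_2]%SET.
have bE i : ratr (b i ord0) = 2 - d.
  by rewrite mxE rmorphB fmorphV /= !ratr_nat.
have cE (x : 'cV[R]_2) : ((map_mx ratr c)^T *m x) ord0 ord0 = x 0 0 + x 1 0.
  by rewrite map_const_mx trmx_const -map_const_mx ratr_ones_mul.
have e_feas (j : 'I_2) : mip_feasible A b L (delta_mx j 0 : 'cV[R]_2).
  split=> [i|i _|i]; last by rewrite inE.
    rewrite ratr_ones_mul bE !mxE !eqxx !andbT.
    by case: j => [[|[|//]] ?] /=; lra.
  by rewrite mxE natr_nat.
have e_hull j : integer_hull A b L (delta_mx j 0 : 'cV[R]_2).
  by apply: sub_convex_hull; exact: e_feas.
pose x : 'cV[R]_2 := \col_i (if i == 0 then 1 else 1 - d).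
have x_lp : lp_feasible A b x.
  split=> i; first by rewrite ratr_ones_mul bE !mxE /=; lra.
  by rewrite mxE; case: ifP => _; lra.
exists 1%N, 2%N, A, b, c, L, [set [set i] | i : 'I_2]%SET, 1, (2 - d).
split; first by move=> j; rewrite mxE.
split; first by exists (delta_mx 0 0); exact: e_feas.
split.
  split; first by exists (delta_mx 0 0); rewrite ?cE ?mxE//= addr0.
  move=> _ [y yI <-]; move: y yI; apply: convex_hull_le => y [Ay yL _].
  have := Ay ord0; rewrite ratr_ones_mul bE cE.
  have /natrP[p ->] := yL 0 (finset.in_setT _).
  have /natrP[q ->] := yL 1 (finset.in_setT _).
  (* The natural number [p + q] is at most [2 - d < 2], hence at most 1. *)
  rewrite -natrD => pq; rewrite lern1 -ltnS -(ltr_nat R).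
  by apply: le_lt_trans pq _; lra.
split; first exact: ltr01.
split; first exact: partition_singletons.
split.
  by apply: is_star_two_singletons => i j; rewrite mxE oner_eq0.
(* With two nodes and [zI = 1], the bound reads [2 - eps <= 2 - d]. *)
split; last by rewrite card_pack_node_singletons mulr1 lerB// ltW.
split.
  exists x; last by rewrite cE !mxE /=; lra.
  move=> _ /imsetP[i _ ->].
  case: (eqVneq i 0) => [->|i0].
    apply: (sparse_closure_agree x_lp (e_hull 0)) => j.
    by rewrite inE => /eqP ->; rewrite !mxE.
  (* The hull point with second coordinate [1 - d] is the combination of the unit vectors with
     weights [d] and [1 - d]. *)
  have d01 : 0 <= d <= 1 by apply/andP; split => //; exact: ltW.
  apply: (sparse_closure_agree x_lp
    (convex_hull_segment d01 (e_hull 0) (e_hull 1))) => j.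
  rewrite inE => /eqP ->; rewrite !mxE (negbTE i0) /=.
  by case: i i0 => [[|[|//]] ?] //= _; lra.
(* For the upper bound, any block yields LP feasibility, and the single row of [A] is the objective
   itself. *)
move=> _ [y ySS <-].
have [|[Ay _] _] := ySS [set 0]%SET; first exact: imset_f.
by rewrite cE; have := Ay ord0; rewrite ratr_ones_mul bE.
Qed.
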